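(* Let $\varepsilon\le 1$. Then \[ S^*_{m,\alpha,\varepsilon,0}=\Omega\left(\frac{k}{m\alpha^2}+\frac{k}{\sqrt{m}\,\alpha\varepsilon}\right). \]
   Context: Let $[k]=\{1,\dots,k\}$ and let $\Delta_k$ be the set of probability distributions on $[k]$. There are $s$ users; each user $u$ holds $m$ samples, and all $sm$ samples are i.i.d. from an unknown $p\in\Delta_k$. An algorithm $A$ maps the users' data to an estimate $\hat p^A\in\Delta_k$, possibly randomized. Two datasets are adjacent if they differ only in the data of a single user. $A$ is $(\varepsilon,\delta)$-differentially private if for all adjacent datasets $D,D'$ and all measurable sets $S$ of outputs, $\Pr[A(D)\in S]\le e^{\varepsilon}\Pr[A(D')\in S]+\delta$. Let $L(A,s,m,p)=\mathbb{E}\left[\sum_{i=1}^k|p_i-\hat p^A_i|\right]$. The user complexity of $A$ is $S^A_{m,\alpha,\varepsilon,\delta}=\min\{s:\sup_{p\in\Delta_k}L(A,s,m,p)\le\alpha\}$, and $S^*_{m,\alpha,\varepsilon,\delta}=\min_A S^A_{m,\alpha,\varepsilon,\delta}$, the minimum over all $(\varepsilon,\delta)$-differentially private algorithms $A$. The constant in $\Omega$ is universal.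
   Formalization: The bound is stated for k ≥ 2, m ≥ 1, 0 < ε ≤ 1 and 0 < α ≤ α₀ with α₀ a universal constant; without this it fails, since for k = 1 or α ≥ 2 a constant output is private and accurate with no users, so S* = 0. *)

(* Defs.v *)
From HB Require Import structures.
From mathcomp Require Import all_boot all_order all_algebra.
From mathcomp Require Import all_classical all_reals all_analysis.
Set Implicit Arguments. Unset Strict Implicit. Unset Printing Implicit Defensive.
Import Order.TTheory GRing.Theory Num.Theory.
Local Open Scope classical_set_scope.
Local Open Scope ring_scope.

(* A dataset: s users, each holding m samples from [k] = 'I_k. *)
Definition dataset (k s m : nat) := {ffun 'I_s -> {ffun 'I_m -> 'I_k}}.

Definition adjacent (k s m : nat) (D D' : dataset k s m) : Prop :=
  exists u : 'I_s, forall v : 'I_s, v != u -> D v = D' v.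

Definition is_distr (R : realType) (k : nat) (p : 'I_k -> R) : Prop :=
  (forall i, 0 <= p i) /\ \sum_(i < k) p i = 1.

(* The simplex Delta_k, as a subset of R^k = k.-tuple R
   (equipped with its product = Borel sigma-algebra). *)
Definition simplex (R : realType) (k : nat) : set (k.-tuple R) :=
  [set x | is_distr (fun i : 'I_k => tnth x i)].

(* A (randomized) algorithm for s users with m samples each: to every
   dataset it associates the distribution of its output estimate. *)
Definition algorithm (R : realType) (k s m : nat) :=
  dataset k s m -> probability (k.-tuple R) R.

Definition outputs_in_simplex (R : realType) (k s m : nat)
  (A : algorithm R k s m) : Prop :=
  forall D, A D (@simplex R k) = 1%E.

Definition differentially_private (R : realType) (k s m : nat)
  (eps delta : R) (A : algorithm R k s m) : Prop :=
  forall D D' : dataset k s m, adjacent D D' ->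
  forall S : set (k.-tuple R), measurable S ->
    (A D S <= (expR eps)%:E * A D' S + delta%:E)%E.

Definition data_prob (R : realType) (k s m : nat) (p : 'I_k -> R)
  (D : dataset k s m) : R :=
  \prod_(u < s) \prod_(j < m) p (D u j).

Definition loss (R : realType) (k s m : nat) (A : algorithm R k s m)
  (p : 'I_k -> R) : \bar R :=
  (\sum_(D : dataset k s m)
     (data_prob p D)%:E *
     \int[A D]_x (\sum_(i < k) `|p i - tnth x i|)%:E)%E.

(* Main.v *)
Require Import Defs.
From HB Require Import structures.
From mathcomp Require Import all_boot all_order all_algebra.
From mathcomp Require Import all_classical all_reals all_analysis.
From mathcomp Require Import measurable_realfun.
From mathcomp Require Import ring lra.
Import Order.TTheory GRing.Theory Num.Theory.
Local Open Scope classical_set_scope.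
Local Open Scope ring_scope.

(* Put h = k/2 and index by v in {-1,1}^h the distributions p_v obtained from
   the uniform one by adding g v_i / k to atom i and subtracting it from its
   twin h + i, with g a constant multiple of alpha. Comparing coordinates with
   1/k decodes an estimate of p_v to a sign vector w with mean Hamming distance
   to v at most k/48, so by Jensen the score exp(-ham(v, w)) has mean at least
   exp(-k/48) under p_v. Under the uniform data distribution the scores sum over
   v to (1 + 1/e)^h, hence some v has mean score at most exp(-h/4) there. The
   ratio between these two means is controlled in two ways:
   - by Cauchy-Schwarz, with the chi-square divergence of the two data
     distributions, at most (1 + g^2)^(s m); this yields k/(m alpha^2);
   - by privacy, replacing the users one at a time: a function that varies by a
     factor of at most exp(eps) in one argument changes its mean by a factor of
     at most 1 + (exp(eps) - 1) times the l1 distance of the two user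
     distributions, which is O(sqrt(m) g); this yields k/(sqrt(m) alpha eps). *)

Set Implicit Arguments.
Unset Strict Implicit.
Unset Printing Implicit Defensive.

(** * Cauchy-Schwarz and chi-square on finite types *)

(** [C * (A * C - B ^+ 2)] is a weighted sum of squares; when [C = 0] every [g x] vanishes. *)
Lemma weighted_cauchy_schwarz (R : realFieldType) (T : finType)
    (w a g : T -> R) : (forall x, 0 < w x) ->
  (\sum_x a x * g x) ^+ 2 <= (\sum_x a x ^+ 2 / w x) * (\sum_x w x * g x ^+ 2).
Proof.
move=> w0.
set A := \sum_x a x ^+ 2 / w x; set B := \sum_x a x * g x.
set C := \sum_x w x * g x ^+ 2.
have wg0 x : 0 <= w x * g x ^+ 2 by rewrite mulr_ge0 ?sqr_ge0 ?ltW.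
have C0 : 0 <= C by apply: sumr_ge0 => x _.
have [C_eq0|C_neq0] := eqVneq C 0.
  have g0 x : g x = 0.
    have /eqP := psumr_eq0P (fun x _ => wg0 x) C_eq0 (erefl : xpredT x).
    by rewrite mulf_eq0 gt_eqF ?w0 //= sqrf_eq0 => /eqP.
  by rewrite C_eq0 mulr0 /B big1 ?expr0n // => x _; rewrite g0 mulr0.
have key : C * (A * C - B ^+ 2) = \sum_x w x * (C * (a x / w x) - B * g x) ^+ 2.
  transitivity (C ^+ 2 * A - (C * B *+ 2) * B + B ^+ 2 * C); first by ring.
  rewrite /A [in X in _ - X]mulr_sumr mulr_sumr [X in _ + X]mulr_sumr
    -sumrB -big_split /=.
  by apply: eq_bigr => x _; field; rewrite gt_eqF.
have C_gt0 : 0 < C by rewrite lt_def C_neq0.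
rewrite -subr_ge0 -(pmulr_rge0 _ C_gt0) key sumr_ge0 // => x _.
by rewrite mulr_ge0 ?sqr_ge0 ?ltW.
Qed.

Lemma sum_prod_ffun (R : comNzRingType) (I T : finType) (F : T -> R) :
  \sum_(f : {ffun I -> T}) \prod_i F (f i) = (\sum_x F x) ^+ #|I|.
Proof. by rewrite -(bigA_distr_bigA (fun=> F)) prodr_const. Qed.

(** Cauchy-Schwarz with weight [nu] against the constant 1; the right side is the chi-square
    divergence, since both masses are 1. *)
Lemma l1_sqr_le_chi2 (R : realFieldType) (T : finType) (mu nu : T -> R) :
  (forall x, 0 < nu x) -> \sum_x mu x = 1 -> \sum_x nu x = 1 ->
  (\sum_x `|mu x - nu x|) ^+ 2 <= \sum_x mu x ^+ 2 / nu x - 1.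
Proof.
move=> nu0 mu1 nu1.
have := weighted_cauchy_schwarz (fun x => `|mu x - nu x|) (fun=> 1) nu0.
under eq_bigr do rewrite mulr1.
under [X in _ <= _ * X]eq_bigr do rewrite expr1n mulr1.
rewrite nu1 mulr1 => /le_trans; apply; rewrite le_eqVlt; apply/orP; left; apply/eqP.
transitivity (\sum_x (mu x ^+ 2 / nu x - mu x *+ 2 + nu x)).
  by apply: eq_bigr => x _; rewrite real_normK ?num_real //; field; rewrite gt_eqF.
by rewrite big_split sumrB sumrMnl mu1 nu1 /=; ring.
Qed.

(** * Changing a product distribution one coordinate at a time *)

Definition update (I T : finType) (D : {ffun I -> T}) (u : I) (x : T) :=
  [ffun v => if v == u then x else D v].

(* The map (D, x) |-> (update D u x, D u) is an involution, so coordinate u can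
   be redrawn from any other distribution nu. *)
Lemma sum_resample (R : comNzRingType) (I T : finType) (u : I)
    (w G : {ffun I -> T} -> R) (mu nu : T -> R) :
  (forall D x, w (update D u x) = w D) -> \sum_x nu x = 1 ->
  \sum_D w D * mu (D u) * G D =
  \sum_D w D * nu (D u) * \sum_x mu x * G (update D u x).
Proof.
move=> wu nu1; symmetry.
transitivity (\sum_D \sum_x w D * nu (D u) * (mu x * G (update D u x))).
  by apply: eq_bigr => D _; rewrite mulr_sumr.
rewrite pair_big /=.
have inv : involutive (fun Dx : {ffun I -> T} * T => (update Dx.1 u Dx.2, Dx.1 u)).
  move=> [D x] /=; rewrite ffunE eqxx; congr (_, _).
  by apply/ffunP => v; rewrite !ffunE; case: eqP => [->|].
rewrite (reindex_inj (inv_inj inv)) /=.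
transitivity (\sum_(Dx : {ffun I -> T} * T) w Dx.1 * mu (Dx.1 u) * G Dx.1 * nu Dx.2).
  apply: eq_bigr => -[D x] _ /=.
  have -> : update (update D u x) u (D u) = D.
    by apply/ffunP => v; rewrite !ffunE; case: eqP => [->|].
  by rewrite wu ffunE eqxx; ring.
rewrite -(pair_big xpredT xpredT (fun D x => w D * mu (D u) * G D * nu x)) /=.
by apply: eq_bigr => D _; rewrite -mulr_sumr nu1 mulr1.
Qed.

(** The [nu]-mean [E] is within a factor [r] of every value of [f], so [f] deviates from it by at
    most [(r - 1) * E]. Equal masses allow [f - E] in place of [f] against [mu - nu]. *)
Lemma expectation_le_of_ratio (R : realFieldType) (T : finType) (r : R)
    (mu nu f : T -> R) : 1 <= r ->
  (forall x, 0 <= nu x) -> \sum_x mu x = 1 -> \sum_x nu x = 1 ->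
  (forall x, 0 <= f x) -> (forall x y, f x <= r * f y) ->
  \sum_x mu x * f x <=
  (1 + (r - 1) * \sum_x `|mu x - nu x|) * \sum_x nu x * f x.
Proof.
move=> r1 nu0 mu1 nu1 f0 fr; set E := \sum_x nu x * f x.
have Er x : f x <= r * E.
  rewrite -[f x]mul1r -nu1 mulr_suml mulr_sumr; apply: ler_sum => y _.
  by rewrite mulrCA; apply: ler_wpM2l.
have rE x : E <= r * f x.
  rewrite -[r * f x]mul1r -nu1 mulr_suml; apply: ler_sum => y _.
  exact: ler_wpM2l.
have dev x : `|f x - E| <= (r - 1) * E.
  have := Er x; have := rE x; have := f0 x.
  have : 0 <= E by apply: sumr_ge0 => y _; rewrite mulr_ge0.
  rewrite ler_norml => *; apply/andP; split; nra.
have -> : \sum_x mu x * f x = E + \sum_x (mu x - nu x) * (f x - E).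
  transitivity (\sum_x (nu x * f x + (mu x - nu x) * (f x - E)) + 0).
    transitivity (\sum_x (mu x * f x + (nu x - mu x) * E)).
      by rewrite big_split /= -mulr_suml sumrB mu1 nu1 subrr mul0r addr0.
    by rewrite addr0; apply: eq_bigr => x _; ring.
  by rewrite addr0 big_split.
rewrite mulrDl mul1r lerD2l mulrAC mulr_sumr.
apply: ler_sum => x _; apply: (le_trans (ler_norm _)); rewrite normrM mulrC.
exact: ler_wpM2r.
Qed.

(** Hybrid argument: [hyb t] draws the first [t] coordinates from [mu] and the others from [nu];
    each increment of [t] costs one factor [1 + eta]. *)
Lemma product_expectation_le (R : realFieldType) (T : finType) (s : nat) (r : R)
    (mu nu : T -> R) (G : {ffun 'I_s -> T} -> R) : 1 <= r ->
  (forall x, 0 <= mu x) -> (forall x, 0 <= nu x) ->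
  \sum_x mu x = 1 -> \sum_x nu x = 1 -> (forall D, 0 <= G D) ->
  (forall (D D' : {ffun 'I_s -> T}) (u : 'I_s),
    (forall v : 'I_s, v != u -> D v = D' v) -> G D <= r * G D') ->
  \sum_(D : {ffun _ -> T}) (\prod_u mu (D u)) * G D <=
  (1 + (r - 1) * \sum_x `|mu x - nu x|) ^+ s *
  \sum_(D : {ffun _ -> T}) (\prod_u nu (D u)) * G D.
Proof.
move=> r1 mu0 nu0 mu1 nu1 G0 Gr; set eta := (r - 1) * _.
have eta0 : 0 <= eta by rewrite mulr_ge0 ?subr_ge0 // sumr_ge0.
pose hyb t (u : 'I_s) := if (u < t)%N then mu else nu.
suff H t : (t <= s)%N ->
    \sum_(D : {ffun _ -> T}) (\prod_u hyb t u (D u)) * G D <=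
    (1 + eta) ^+ t * \sum_(D : {ffun _ -> T}) (\prod_u nu (D u)) * G D.
  apply: le_trans (H _ (leqnn s)); rewrite le_eqVlt; apply/orP; left; apply/eqP.
  apply: eq_bigr => D _; congr (_ * _); apply: eq_bigr => u _.
  by rewrite /hyb ltn_ord.
elim: t => [_|t IH ts]; first by rewrite expr0 mul1r.
have := IH (ltnW ts); rewrite exprS -mulrA => /(ler_wpM2l (_ : 0 <= 1 + eta)).
move=> /(_ (addr_ge0 ler01 eta0)); apply: le_trans.
pose u0 := Ordinal ts.
pose w (D : {ffun 'I_s -> T}) := \prod_(u | u != u0) hyb t u (D u).
have wu D x : w (update D u0 x) = w D.
  by apply: eq_bigr => u /negPf u_u0; rewrite ffunE u_u0.
have hybE t' (D : {ffun 'I_s -> T}) :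
    (forall u, u != u0 -> hyb t' u = hyb t u) ->
    \prod_u hyb t' u (D u) = w D * hyb t' u0 (D u0).
  move=> hu; rewrite (bigD1 u0) //= mulrC; congr (_ * _).
  by apply: eq_bigr => u u_u0; rewrite hu.
have hybS u : u != u0 -> hyb t.+1 u = hyb t u.
  move=> u_u0; rewrite /hyb ltnS leq_eqVlt (_ : (u == t :> nat) = false) //.
  exact/negbTE.
under eq_bigr do rewrite (hybE _ _ hybS) /hyb /= ltnSn.
under [X in _ <= _ * X]eq_bigr do rewrite (hybE t) // /hyb /= ltnn.
(* Both hybrids get the same outer weight, with [nu] at [u0]; they now differ only in the inner mean
   over [x]. *)
rewrite (sum_resample G mu wu nu1) (sum_resample G nu wu nu1) mulr_sumr.
apply: ler_sum => D _; rewrite mulrCA; apply: ler_wpM2l.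
  rewrite mulr_ge0 // prodr_ge0 // => u _.
  by rewrite /hyb; case: ifP.
apply: expectation_le_of_ratio => // x y; apply: (Gr _ _ u0) => v v_u0.
by rewrite !ffunE (negPf v_u0).
Qed.

(** * Exponential inequalities *)

(** Squaring [1 - x / 2 <= expR (- (x / 2))] bounds [expR x * (1 - x / 2) ^+ 2] by 1, while
    [(1 + 3 * x) * (1 - x / 2) ^+ 2] is at least 1. *)
Lemma expR_le1D3x (R : realType) (x : R) : 0 <= x <= 1 -> expR x <= 1 + 3 * x.
Proof.
move=> /andP[x0 x1].
have h := expR_ge1Dx (- (x / 2)).
have e1 : expR x = expR (x / 2) ^+ 2 by rewrite -expRM_natl; congr (expR _); field.
have e2 : expR (x / 2) * expR (- (x / 2)) = 1 by rewrite -expRD subrr expR0.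
have e0 := expR_gt0 (x / 2).
rewrite e1; set y := expR (x / 2) in e0 e2 *.
have hy : y * (1 - x / 2) <= 1.
  by rewrite -[leRHS]e2; apply: ler_wpM2l h; apply: ltW e0.
have : (y * (1 - x / 2)) ^+ 2 <= 1.
  have := mulr_ge0 (ltW e0) (_ : 0 <= 1 - x / 2).
  move=> /(_ ltac:(lra)) ?.
  by rewrite expr_le1.
rewrite exprMn => h2.
have : 1 <= (1 + 3 * x) * (1 - x / 2) ^+ 2.
  have -> : (1 + 3 * x) * (1 - x / 2) ^+ 2 = 1 + x * (1 - x) * (2 - 3 / 4 * x).
    by field.
  by rewrite lerDl !mulr_ge0 //; lra.
have : 0 < (1 - x / 2) ^+ 2 by apply: exprn_gt0; lra.
move=> p0 h3; rewrite -(ler_pM2r p0); exact: le_trans h2 h3.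
Qed.

(** Jensen's inequality, through the tangent line of [expR (- y)] at [y = a]. *)
Lemma expR_mean_le (R : realType) (T : finType) (p y : T -> R) (a : R) :
  (forall x, 0 <= p x) -> \sum_x p x = 1 -> \sum_x p x * y x <= a ->
  expR (- a) <= \sum_x p x * expR (- y x).
Proof.
move=> p0 p1 ya.
apply: (@le_trans _ _ (\sum_x p x * (expR (- a) * (1 + (a - y x))))).
  have -> : \sum_x p x * (expR (- a) * (1 + (a - y x))) =
      expR (- a) * ((1 + a) * \sum_x p x - \sum_x p x * y x).
    rewrite mulrBr !mulr_sumr -sumrB; apply: eq_bigr => x _; ring.
  rewrite p1 mulr1; apply: ler_peMr; first exact: expR_ge0.
  by rewrite -addrA lerDl subr_ge0.
apply: ler_sum => x _; apply: ler_wpM2l => //.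
have e : - y x = - a + (a - y x) by ring.
by rewrite [in leRHS]e expRD; apply: ler_wpM2l; rewrite ?expR_ge0 ?expR_ge1Dx.
Qed.

(** * Hamming distance and the exponential score *)

Definition hamming (h : nat) (v w : {ffun 'I_h -> bool}) : nat :=
  \sum_i (v i != w i).

Lemma sum_expR_hamming (R : realType) (h : nat) (w : {ffun 'I_h -> bool}) :
  \sum_(v : {ffun 'I_h -> bool}) expR (- (hamming v w)%:R : R) =
  (1 + expR (- 1)) ^+ h.
Proof.
transitivity (\sum_(v : {ffun 'I_h -> bool}) \prod_i expR (- (v i != w i)%:R : R)).
  by apply: eq_bigr => v _; rewrite -expR_sum sumrN -natr_sum.
rewrite -(bigA_distr_bigA (fun i b => expR (- (b != w i)%:R : R))) /=.
rewrite -[h in RHS]card_ord -prodr_const; apply: eq_bigr => i _.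
by rewrite big_bool; case: (w i); rewrite /= oppr0 expR0 // addrC.
Qed.

Section HammingScore.
Context (R : realType) (Omega : finType) (h : nat).
Variable q : Omega -> {ffun 'I_h -> bool} -> R.
Hypothesis q_ge0 : forall D w, 0 <= q D w.
Hypothesis q_sum1 : forall D, \sum_w q D w = 1.

(** [q D] is the law of the decoded vector on data [D]. Being linear in [q] with nonnegative
    weights, the score inherits multiplicative privacy bounds. *)
Definition score v D : R := \sum_w q D w * expR (- (hamming v w)%:R).

Lemma score_ge0 v D : 0 <= score v D.
Proof. by apply: sumr_ge0 => w _; rewrite mulr_ge0 ?expR_ge0. Qed.

Lemma score_le1 v D : score v D <= 1.
Proof.
rewrite -(q_sum1 D); apply: ler_sum => w _.
by rewrite ler_piMr // -expR0 ler_expR lerNl oppr0 ler0n.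
Qed.

Lemma mean_score_ge (P : Omega -> R) (v : {ffun 'I_h -> bool}) (a : R) :
  (forall D, 0 <= P D) -> \sum_D P D = 1 ->
  \sum_D P D * \sum_w q D w * (hamming v w)%:R <= a ->
  expR (- a) <= \sum_D P D * score v D.
Proof.
move=> P0 P1 Pa.
have pairE (f : {ffun 'I_h -> bool} -> R) : \sum_D P D * \sum_w q D w * f w =
    \sum_(Dw : Omega * {ffun 'I_h -> bool}) P Dw.1 * q Dw.1 Dw.2 * f Dw.2.
  rewrite -(pair_big xpredT xpredT (fun D w => P D * q D w * f w)) /=.
  by apply: eq_bigr => D _; rewrite mulr_sumr; apply: eq_bigr => w _; rewrite mulrA.
rewrite pairE in Pa; rewrite pairE; apply: expR_mean_le => [Dw||].
- by rewrite mulr_ge0.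
- rewrite -P1 -(pair_big xpredT xpredT (fun D w => P D * q D w)) /=.
  by apply: eq_bigr => D _; rewrite -mulr_sumr q_sum1 mulr1.
- exact: Pa.
Qed.

(** Otherwise the scores would sum over [v] to more than [(2 * expR (- (1 / 4))) ^+ h], which is at
    least their actual total [(1 + expR (- 1)) ^+ h]. *)
Lemma exists_small_score (nu : Omega -> R) : 
  (forall D, 0 <= nu D) -> \sum_D nu D = 1 ->
  exists v, \sum_D nu D * score v D <= expR (- (h%:R / 4)).
Proof.
move=> nu0 nu1; apply: contrapT => /forallNP big.
have : \sum_(v : {ffun 'I_h -> bool}) expR (- (h%:R / 4)) <
    \sum_v \sum_D nu D * score v D.
  apply: ltr_sum => [|v _].
    by apply/hasP; exists ([ffun=> true] : {ffun 'I_h -> bool});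
      rewrite ?mem_index_enum.
  by rewrite ltNge; apply/negP; exact: big.
rewrite exchange_big /=.
under [X in _ < X]eq_bigr do rewrite -mulr_sumr exchange_big /=.
have -> : \sum_D nu D * (\sum_w \sum_v q D w * expR (- (hamming v w)%:R)) =
    (1 + expR (- 1)) ^+ h.
  rewrite -[RHS]mul1r -[X in _ = X * _]nu1 mulr_suml.
  apply: eq_bigr => D _; congr (_ * _).
  rewrite -[RHS]mul1r -[X in _ = X * _](q_sum1 D) mulr_suml.
  by apply: eq_bigr => w _; rewrite -mulr_sumr sum_expR_hamming.
rewrite sumr_const card_ffun card_bool card_ord -[X in X < _]mulr_natl natrX.
have -> : - (h%:R / 4) = h%:R * (- (1 / 4)) :> R by ring.
rewrite expRM_natl -exprMn ltNge => /negP; apply.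
apply: lerXn2r; rewrite ?nnegrE ?addr_ge0 ?mulr_ge0 ?expR_ge0 //.
(* The two bases are separated by 3/2: [expR 1 >= 2] and [expR (- (1 / 4)) >= 3 / 4]. *)
have := expR_ge1Dx (- (1 / 4) : R); have := expR_ge1Dx (1 : R).
have : expR 1 * expR (- 1) = 1 :> R by rewrite -expRD subrr expR0.
have := expR_gt0 (- 1 : R).
nra.
Qed.
End HammingScore.

(** Tensorization: one plus the chi-square divergence is multiplicative over independent
    coordinates. *)
Lemma sum_chi2_prod (R : fieldType) (I T : finType) (mu nu : T -> R) :
  \sum_(f : {ffun I -> T}) (\prod_i mu (f i)) ^+ 2 / \prod_i nu (f i) =
  (\sum_x mu x ^+ 2 / nu x) ^+ #|I|.
Proof.
rewrite -sum_prod_ffun; apply: eq_bigr => f _.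
by rewrite -prodrXl -prodf_div.
Qed.

(** * Integrating functions of a finitely-valued decoder *)

Section FiniteDecoder.
Context d (T : measurableType d) (R : realType) (W : finType) (dec : T -> W).
Hypothesis measurable_fiber : forall w, measurable [set x | dec x = w].

Lemma comp_decoderE (f : W -> R) x :
  (f (dec x))%:E = (\sum_w (f w)%:E * (\1_[set y | dec y = w] x)%:E)%E.
Proof.
rewrite (bigD1 (dec x)) //= big1 ?adde0 => [|w w_dec].
  by rewrite indicE mem_set // mule1.
rewrite indicE memNset ?mule0 //= => dec_w.
by rewrite dec_w eqxx in w_dec.
Qed.

Lemma measurable_comp_decoder (f : W -> R) :
  measurable_fun setT ((fun x => (f (dec x))%:E) : T -> \bar R).
Proof.
under eq_fun do rewrite comp_decoderE.
apply: emeasurable_sum => w; apply: measurable_funeM.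
by apply/measurable_EFinP; exact: measurable_indic.
Qed.

Lemma integral_comp_decoder (mu : probability T R) (f : W -> R) :
  (forall w, 0 <= f w) ->
  (\int[mu]_x (f (dec x))%:E)%E = (\sum_w f w * fine (mu [set x | dec x = w]))%:E.
Proof.
move=> f0; under eq_integral do rewrite comp_decoderE.
have mind w : measurable_fun setT ((fun x => (\1_[set y | dec y = w] x)%:E) : T -> \bar R).
  by apply/measurable_EFinP; exact: measurable_indic.
rewrite ge0_integral_sum //.
- rewrite -sumEFin; apply: eq_bigr => w _.
  rewrite ge0_integralZl_EFin // integral_indic // setIT EFinM fineK //.
  exact: fin_num_measure.
- by move=> w; apply: measurable_funeM.
- by move=> w x _; rewrite mule_ge0 ?lee_fin.
Qed.
End FiniteDecoder.

(** * The perturbed distributions and the sign decoder *)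

Section Perturbation.
Context (R : realType) (k h : nat) (g : R).
Implicit Types (v w : {ffun 'I_h -> bool}).

(** Extended by 0 to all naturals, so that the shift by [h] to the twin atom needs no ordinal
    cast. *)
Definition sgn v (j : nat) : R :=
  if insub j is Some i then (if v i then 1 else - 1) else 0.

(* +-1 on [0, h), the opposite signs on [h, 2h), and 0 from 2h on. *)
Definition tilt v (j : nat) : R :=
  sgn v j - (if (h <= j)%N then sgn v (j - h) else 0).

Definition perturbed v (i : 'I_k) : R := (1 + g * tilt v i) / k%:R.

Lemma sgn_out v j : (h <= j)%N -> sgn v j = 0.
Proof. by move=> hj; rewrite /sgn insubN // -leqNgt. Qed.

Lemma sgn_bound v j : `|sgn v j| <= 1.
Proof.
rewrite /sgn; case: insub => [i|]; last by rewrite normr0.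
by case: (v i); rewrite ?normrN normr1.
Qed.

Lemma tilt_bound v j : `|tilt v j| <= 1.
Proof.
rewrite /tilt; case: leqP => [hj|_]; last by rewrite subr0 sgn_bound.
by rewrite sgn_out // sub0r normrN sgn_bound.
Qed.

Lemma tilt_ord v (i : 'I_h) : tilt v i = if v i then 1 else - 1.
Proof. by rewrite /tilt leqNgt ltn_ord subr0 /sgn valK. Qed.

Lemma sum_sgn v n : (h <= n)%N ->
  \sum_(0 <= j < n) sgn v j = \sum_(0 <= j < h) sgn v j.
Proof.
move=> hn; rewrite (big_cat_nat (leq0n h) hn) //= [X in _ + X]big_nat_cond.
by rewrite [X in _ + X]big1 ?addr0 // => j /andP[/andP[hj _] _]; rewrite sgn_out.
Qed.

Hypothesis hk : (h + h <= k)%N.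

(** The negative block is a shifted copy of the positive one, and [h + h <= k] leaves room for all
    of it. *)
Lemma sum_tilt v : \sum_(i < k) tilt v i = 0.
Proof.
have hk' : (h <= k)%N by apply: leq_trans hk; exact: leq_addr.
rewrite sumrB -(big_mkord xpredT (sgn v)) sum_sgn //.
rewrite -(big_mkord xpredT (fun j => if (h <= j)%N then sgn v (j - h) else 0)).
rewrite (big_cat_nat (leq0n h) hk') //= [X in _ - (X + _)]big_nat_cond
  [X in _ - (X + _)]big1 ?add0r.
  rewrite -[h in \sum_(h <= _ < k) _]add0n big_addn.
  under [X in _ - X]eq_bigr do rewrite leq_addl addnK.
  by rewrite (@sum_sgn v (k - h)) ?subrr // leq_subRL.
by move=> j /andP[/andP[_ jh] _]; rewrite leqNgt jh.
Qed.

Hypothesis k_gt0 : (0 < k)%N.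
Hypothesis g01 : 0 <= g <= 1.

Let kR_gt0 : 0 < k%:R :> R. Proof. by rewrite ltr0n. Qed.

Lemma perturbed_ge0 v i : 0 <= perturbed v i.
Proof.
apply: divr_ge0; last exact: ltW.
have := tilt_bound v i; rewrite ler_norml => /andP[t1 t2].
by case/andP: g01 => *; nra.
Qed.

Lemma sum_perturbed v : \sum_i perturbed v i = 1.
Proof.
rewrite -mulr_suml big_split /= -mulr_sumr sum_tilt mulr0 addr0.
by rewrite sumr_const card_ord divff ?gt_eqF.
Qed.

(** The term linear in [g] cancels by [sum_tilt], leaving only the quadratic one. *)
Lemma chi2_perturbed v :
  \sum_i perturbed v i ^+ 2 / k%:R^-1 <= 1 + g ^+ 2.
Proof.
have k0 : k%:R != 0 :> R by rewrite gt_eqF.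
have -> : \sum_i perturbed v i ^+ 2 / k%:R^-1 =
    (\sum_(i < k) (1 + 2 * g * tilt v i + g ^+ 2 * tilt v i ^+ 2)) / k%:R.
  rewrite mulr_suml; apply: eq_bigr => i _.
  by rewrite /perturbed; field.
rewrite !big_split /= -mulr_sumr sum_tilt mulr0 addr0 sumr_const card_ord.
rewrite ler_pdivrMr // mulrDl mul1r lerD2l -mulr_sumr ler_wpM2l ?sqr_ge0 //.
rewrite -[leRHS](_ : \sum_(i < k) 1 = _); last by rewrite sumr_const card_ord.
apply: ler_sum => i _; rewrite -real_normK ?num_real //.
by rewrite expr_le1 ?tilt_bound.
Qed.

Lemma perturbed_far v (i : 'I_k) (j : 'I_h) (y : R) : i = j :> nat ->
  v j != (k%:R^-1 <= y) -> g / k%:R <= `|perturbed v i - y|.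
Proof.
move=> ij; rewrite /perturbed ij tilt_ord.
case: (v j); case: lerP => //= hy _.
  rewrite ler_normr; apply/orP; left.
  by rewrite mulr1 mulrDl mul1r -addrAC; lra.
rewrite ler_normr; apply/orP; right.
by rewrite mulrN1 mulrBl mul1r; lra.
Qed.

(** Only the first [h] atoms are read; their twins carry the same signs, reversed. *)
Definition decode (x : k.-tuple R) : {ffun 'I_h -> bool} :=
  [ffun j => k%:R^-1 <= tnth x (widen_ord (leq_trans (leq_addr h h) hk) j)].

Lemma measurable_decode w : measurable [set x | decode x = w].
Proof.
have -> : [set x | decode x = w] = \big[setI/setT]_(j < h)
    ((fun x : k.-tuple R =>
        tnth x (widen_ord (leq_trans (leq_addr h h) hk) j)) @^-1`
     [set y | (k%:R^-1 <= y) = w j]).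
  apply/seteqP; split => [x /= <-|x].
    by rewrite -bigcap_seq => j _ /=; rewrite ffunE.
  by rewrite -bigcap_seq => xw; apply/ffunP => j;
    rewrite ffunE; apply: xw; rewrite /= mem_index_enum.
apply: bigsetI_measurable => j _; rewrite -[X in measurable X]setTI.
apply: measurable_tnth => //.
case: (w j).
  have -> : [set y | (k%:R^-1 <= y) = true] = [set` `[k%:R^-1, +oo[ ] :> set R.
    by apply/seteqP; split => y /=; rewrite in_itv /= andbT.
  exact: measurable_itv.
have -> : [set y | (k%:R^-1 <= y) = false] = [set` `]-oo, k%:R^-1[ ] :> set R.
  by apply/seteqP; split => y /=; rewrite in_itv /= ltNge; [move=> ->|move/negbTE].
exact: measurable_itv.
Qed.

(** Each wrong bit puts its coordinate on the wrong side of [k%:R^-1], at cost [g / k%:R] by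
    [perturbed_far]; atoms from [h] on are dropped. *)
Lemma hamming_decode_le v (x : k.-tuple R) :
  g / k%:R * (hamming v (decode x))%:R <=
  \sum_(i < k) `|perturbed v i - tnth x i|.
Proof.
have hk' := leq_trans (leq_addr h h) hk.
rewrite (bigID (fun i : 'I_k => (i < h)%N)) /= -[leLHS]addr0 lerD ?sumr_ge0 //.
rewrite (big_ord_narrow hk') natr_sum mulr_sumr; apply: ler_sum => j _.
have [_|ne] := eqVneq; first by rewrite mulr0.
rewrite mulr1; apply: (perturbed_far (j := j)) => //.
move: ne; rewrite ffunE; congr (_ != (_ <= tnth _ _)).
exact: val_inj.
Qed.
End Perturbation.

(** * Comparing the data distributions, for one user and for all users *)

Section LowerBounds.
Context (R : realType) (k m s h : nat) (g : R).
Hypothesis hk : (h + h <= k)%N.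
Hypothesis k_gt0 : (0 < k)%N.
Hypothesis g01 : 0 <= g <= 1.
Implicit Types (v w : {ffun 'I_h -> bool}).

Let user := {ffun 'I_m -> 'I_k}.

Definition user_prob v (y : user) : R := \prod_j perturbed g v (y j).

Definition user_unif (y : user) : R := \prod_(j < m) k%:R^-1.

Let kR_gt0 : 0 < k%:R :> R. Proof. by rewrite ltr0n. Qed.

Lemma user_prob_ge0 v y : 0 <= user_prob v y.
Proof. by apply: prodr_ge0 => j _; exact: perturbed_ge0. Qed.

Lemma user_unif_gt0 y : 0 < user_unif y.
Proof. by apply: prodr_gt0 => j _; rewrite invr_gt0. Qed.

Lemma sum_user_prob v : \sum_y user_prob v y = 1.
Proof. by rewrite sum_prod_ffun sum_perturbed ?expr1n. Qed.

Lemma sum_user_unif : \sum_y user_unif y = 1.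
Proof.
rewrite (sum_prod_ffun _ (fun=> k%:R^-1)) sumr_const card_ord.
by rewrite -[_^-1 *+ _]mulr_natl divff ?gt_eqF // expr1n.
Qed.

Lemma chi2_user_le v :
  \sum_y user_prob v y ^+ 2 / user_unif y <= expR (m%:R * g ^+ 2).
Proof.
rewrite (sum_chi2_prod _ (perturbed g v) (fun=> k%:R^-1)) card_ord expRM_natl.
apply: lerXn2r; rewrite ?nnegrE ?expR_ge0 //.
  by apply: sumr_ge0 => i _; rewrite mulr_ge0 ?sqr_ge0 ?invrK ?ltW.
exact: (le_trans (chi2_perturbed _ hk k_gt0 v) (expR_ge1Dx _)).
Qed.

(** With [z = Num.sqrt m%:R * g]: if [z <= 1], the squared distance is at most
    [expR (z ^+ 2) - 1 <= 3 * z ^+ 2]; if [z > 1], the trivial bound 2 suffices. *)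
Lemma l1_user_le v :
  \sum_y `|user_prob v y - user_unif y| <= 2 * (Num.sqrt m%:R * g).
Proof.
set l1 := \sum_y _.
have l1_sq : l1 ^+ 2 <= expR (m%:R * g ^+ 2) - 1.
  apply: (le_trans (l1_sqr_le_chi2 user_unif_gt0 (sum_user_prob v) sum_user_unif)).
  by rewrite lerD2r chi2_user_le.
have l1_le2 : l1 <= 2.
  apply: (@le_trans _ _ (\sum_y (user_prob v y + user_unif y))).
    apply: ler_sum => y _; apply: (le_trans (ler_normB _ _)).
    by rewrite !ger0_norm ?user_prob_ge0 // ltW ?user_unif_gt0.
  by rewrite big_split /= sum_user_prob sum_user_unif.
have g0 : 0 <= g by case/andP: g01.
have l1_ge0 : 0 <= l1 by apply: sumr_ge0.
have sg0 : 0 <= Num.sqrt m%:R * g by rewrite mulr_ge0 ?sqrtr_ge0.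
have sqE : m%:R * g ^+ 2 = (Num.sqrt m%:R * g) ^+ 2.
  by rewrite exprMn sqr_sqrtr ?ler0n.
rewrite sqE in l1_sq; move: sg0 l1_sq; set z := Num.sqrt _ * _ => z0 l1_sq.
have [z1|/ltW z1] := leP z 1; last by apply: (le_trans l1_le2); lra.
rewrite -(@ler_pXn2r _ 2) ?nnegrE ?mulr_ge0 //; apply: (le_trans l1_sq).
have : 0 <= z ^+ 2 <= 1 by rewrite sqr_ge0 expr_le1.
move=> /expR_le1D3x he; have z2 := sqr_ge0 z.
have -> : (2 * z) ^+ 2 = 4 * z ^+ 2 by ring.
by move: he z2; set e := expR _; set z2 := z ^+ 2 => ? ?; lra.
Qed.

Let data_probE v (D : dataset k s m) :
  data_prob (perturbed g v) D = \prod_u user_prob v (D u).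
Proof. by []. Qed.

Lemma data_prob_ge0 v (D : dataset k s m) : 0 <= data_prob (perturbed g v) D.
Proof. by rewrite data_probE prodr_ge0 // => u _; exact: user_prob_ge0. Qed.

Lemma sum_data_prob v : \sum_(D : dataset k s m) data_prob (perturbed g v) D = 1.
Proof. by rewrite (sum_prod_ffun _ (user_prob v)) sum_user_prob expr1n. Qed.

Definition data_unif (D : dataset k s m) : R := \prod_u user_unif (D u).

Lemma data_unif_gt0 D : 0 < data_unif D.
Proof. by apply: prodr_gt0 => u _; exact: user_unif_gt0. Qed.

Lemma sum_data_unif : \sum_D data_unif D = 1.
Proof. by rewrite (sum_prod_ffun _ user_unif) sum_user_unif expr1n. Qed.

(** Cauchy-Schwarz, with the chi-square factor tensorized over users and [G D ^+ 2 <= G D]. *)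
Lemma sqr_mean_le v (G : dataset k s m -> R) : (forall D, 0 <= G D <= 1) ->
  (\sum_D data_prob (perturbed g v) D * G D) ^+ 2 <=
  expR (s%:R * (m%:R * g ^+ 2)) * \sum_D data_unif D * G D.
Proof.
move=> G01; apply: (le_trans (weighted_cauchy_schwarz _ G data_unif_gt0)).
have unif_ge0 D := ltW (data_unif_gt0 D).
apply: ler_pM.
- by apply: sumr_ge0 => D _; rewrite divr_ge0 ?sqr_ge0.
- by apply: sumr_ge0 => D _; rewrite mulr_ge0 ?sqr_ge0.
- rewrite (sum_chi2_prod _ (user_prob v) user_unif) card_ord expRM_natl.
  apply: lerXn2r; rewrite ?nnegrE ?expR_ge0 ?chi2_user_le //.
  by apply: sumr_ge0 => y _; rewrite divr_ge0 ?sqr_ge0 // ltW ?user_unif_gt0.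
- apply: ler_sum => D _; apply: ler_wpM2l => //.
  by have /andP[G0 G1] := G01 D; rewrite expr2 ler_piMl.
Qed.

(** The constant 6 is 3 from [expR eps - 1 <= 3 * eps] times 2 from [l1_user_le]. *)
Lemma private_mean_le v (eps : R) (G : dataset k s m -> R) :
  0 <= eps <= 1 -> (forall D, 0 <= G D) ->
  (forall D D', Defs.adjacent D D' -> G D <= expR eps * G D') ->
  \sum_D data_prob (perturbed g v) D * G D <=
  expR (s%:R * (6 * eps * (Num.sqrt m%:R * g))) * \sum_D data_unif D * G D.
Proof.
move=> eps01 G0 Gadj; have /andP[eps0 eps1] := eps01.
have r1 : 1 <= expR eps by rewrite -expR0 ler_expR.
apply: (le_trans (product_expectation_le r1 (user_prob_ge0 v)
  (fun y => ltW (user_unif_gt0 y)) (sum_user_prob v) sum_user_unif G0 _)).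
  by move=> D D' u DD'; apply: Gadj; exists u.
apply: ler_wpM2r; first by
  apply: sumr_ge0 => D _; rewrite mulr_ge0 // ltW ?data_unif_gt0.
rewrite expRM_natl; set l1 := \sum_y _.
have l1_ge0 : 0 <= l1 by apply: sumr_ge0.
apply: lerXn2r; rewrite ?nnegrE ?expR_ge0 ?addr_ge0 ?mulr_ge0 ?subr_ge0 //.
apply: le_trans (expR_ge1Dx _); rewrite lerD2l.
have -> : 6 * eps * (Num.sqrt m%:R * g) = (3 * eps) * (2 * (Num.sqrt m%:R * g)).
  by ring.
apply: ler_pM; rewrite ?subr_ge0 ?l1_user_le //.
by rewrite lerBlDl expR_le1D3x.
Qed.

(** * Accuracy and privacy of the decoded output *)

Definition decoded_prob (A : algorithm R k s m) (D : dataset k s m) w : R :=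
  fine (A D [set x | decode hk x = w]).

Lemma decoded_prob_ge0 A D w : 0 <= decoded_prob A D w.
Proof. by rewrite fine_ge0 ?measure_ge0. Qed.

Lemma sum_decoded_prob A D : \sum_w decoded_prob A D w = 1.
Proof.
have := integral_comp_decoder (measurable_decode hk) (A D)
  (f := fun=> 1) (fun=> ler01).
rewrite integral_cst // mul1e => /esym e; apply: EFin_inj.
transitivity (A D setT); last exact: probability_setT.
by apply: etrans e; congr EFin; apply: eq_bigr => w _; rewrite mul1r.
Qed.

(** [hamming_decode_le] integrated over the output of [A], then averaged over the data. *)
Lemma mean_hamming_le A v (alpha : R) :
  (loss A (perturbed g v) <= alpha%:E)%E ->
  g / k%:R * (\sum_D data_prob (perturbed g v) D *
    \sum_w decoded_prob A D w * (hamming v w)%:R) <= alpha.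
Proof.
have g0 : 0 <= g by case/andP: g01.
rewrite -lee_fin; apply: le_trans; rewrite mulr_sumr -sumEFin.
apply: lee_sum => D _; rewrite mulrCA EFinM.
apply: lee_wpmul2l; first by rewrite lee_fin data_prob_ge0.
rewrite mulr_sumr; under eq_bigr do rewrite mulrCA mulrC.
have f0 w : 0 <= g / k%:R * (hamming v w)%:R.
  by rewrite mulr_ge0 ?divr_ge0 ?ler0n.
rewrite -(integral_comp_decoder (measurable_decode hk) (A D) f0).
apply: ge0_le_integral => //.
- by move=> x _; rewrite lee_fin.
- exact: (measurable_comp_decoder (measurable_decode hk)
    (fun w => g / k%:R * (hamming v w)%:R)).
- apply/measurable_EFinP; apply: measurable_sum => i.
  apply: measurableT_comp => //; apply: measurable_funB => //.
  exact: measurable_tnth.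
- by move=> x _; rewrite lee_fin hamming_decode_le.
Qed.

(** Privacy is applied to each fiber of the decoder; with [delta = 0] the bounds add up without an
    additive error. *)
Lemma score_private A (eps : R) v : differentially_private eps 0 A ->
  forall D D', Defs.adjacent D D' ->
  score (decoded_prob A) v D <= expR eps * score (decoded_prob A) v D'.
Proof.
move=> dp D D' DD'; rewrite mulr_sumr; apply: ler_sum => w _.
rewrite mulrA; apply: ler_wpM2r; first exact: expR_ge0.
have := dp D D' DD' _ (measurable_decode hk w).
rewrite adde0 /decoded_prob.
by rewrite -lee_fin EFinM !fineK ?fin_num_measure //; exact: measurable_decode.
Qed.
End LowerBounds.

Unset Implicit Arguments.
Set Strict Implicit.
Set Printing Implicit Defensive.

(* S*_{m,alpha,eps,0} = Omega(k/(m alpha^2) + k/(sqrt m alpha eps)) for eps <= 1: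
   there are universal constants c > 0 and alpha0 > 0 such that every
   (eps,0)-DP algorithm whose worst-case expected l1 loss with s users is at
   most alpha needs s >= c (k/(m alpha^2) + k/(sqrt m alpha eps)). *)
Theorem theorem3 (R : realType) :
  exists c : R, exists alpha0 : R, 0 < c /\ 0 < alpha0 /\
  forall (k m s : nat) (alpha eps : R),
    (2 <= k)%N -> (1 <= m)%N -> 0 < alpha -> alpha <= alpha0 ->
    0 < eps -> eps <= 1 ->
    forall A : algorithm R k s m,
      outputs_in_simplex A ->
      differentially_private eps 0 A ->
      (forall p : 'I_k -> R, is_distr p -> (loss A p <= alpha%:E)%E) ->
      c * (k%:R / (m%:R * alpha ^+ 2) + k%:R / (Num.sqrt m%:R * alpha * eps))
        <= s%:R.
Proof.
(* [alpha <= 48^-1] ensures [g <= 1]. The final bounds have constants 24 * 48 * 48 = 55296 and 16 *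
   6 * 48 = 4608, whose sum is below 300 * 400. *)
exists (300 * 400)^-1, 48^-1; split; first lra; split; first lra.
move=> k m s alpha eps k2 m1 alpha0 alpha48 eps0 eps1 A _ dp_A loss_A.
pose h := k./2; pose g := 48 * alpha.
have hk : (h + h <= k)%N by rewrite addnn -[leqRHS]odd_double_half leq_addl.
have k_gt0 : (0 < k)%N by apply: leq_trans k2.
have g01 : 0 <= g <= 1 by apply/andP; split; rewrite /g; lra.
(* Rounding costs most at [k = 3], [h = 1]; hence [h / 4 >= k / 12] below. *)
have k_le3h : k%:R <= 3 * h%:R :> R.
  rewrite -natrM ler_nat -[leqLHS]odd_double_half -/h -addnn.
  rewrite mulSn mulSn mul1n leq_add2r.
  by apply: leq_trans (leq_b1 _) _; rewrite half_gt0.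
have kR : 0 < k%:R :> R by rewrite ltr0n.
have mR : 0 < m%:R :> R by rewrite ltr0n.
have sqrt_m : 0 < Num.sqrt m%:R :> R by rewrite sqrtr_gt0.
pose sc := score (decoded_prob hk A).
have sc_ge0 v D : 0 <= sc v D by apply: score_ge0 => *; exact: decoded_prob_ge0.
have sc_le1 v D : sc v D <= 1.
  apply: score_le1 => *; [exact: decoded_prob_ge0|exact: sum_decoded_prob].
have [v sc_unif] := exists_small_score (sum_decoded_prob hk A)
  (fun D => ltW (data_unif_gt0 R k_gt0 D)) (sum_data_unif R m s k_gt0).
rewrite -/sc in sc_unif.
have p_distr : is_distr (perturbed g v : 'I_k -> R).
  by split=> [i|]; [exact: (perturbed_ge0 k_gt0 g01)|
    exact: (sum_perturbed g hk k_gt0)].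
(* The mean Hamming distance is at most [alpha * k / g = k / 48]. *)
have sc_v : expR (- (k%:R / 48)) <= \sum_D data_prob (perturbed g v) D * sc v D.
  apply: mean_score_ge => //.
  - exact: decoded_prob_ge0.
  - exact: sum_decoded_prob.
  - exact: data_prob_ge0.
  - exact: sum_data_prob.
  - have := mean_hamming_le hk k_gt0 g01 (loss_A _ p_distr).
    set X := \sum_D _ => le_alpha.
    have c_gt0 : 0 < g / k%:R by rewrite divr_gt0 // /g; lra.
    rewrite -(ler_pM2l c_gt0); apply: (le_trans le_alpha).
    rewrite le_eqVlt; apply/orP; left; apply/eqP.
    by rewrite /g; field; rewrite gt_eqF.
(* Squaring the mean score doubles its exponent: k/12 - 2k/48 = k/24. *)
have sampling : k%:R / 24 <= s%:R * (m%:R * g ^+ 2).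
  have sc01 D : 0 <= sc v D <= 1 by rewrite sc_ge0 sc_le1.
  have := sqr_mean_le g hk k_gt0 v sc01.
  move=> /(le_trans (lerXn2r 2 _ _ sc_v)); rewrite !nnegrE expR_ge0.
  rewrite (le_trans (expR_ge0 _) sc_v) => /(_ isT isT) => sq_le.
  have := le_trans sq_le (ler_wpM2l (expR_ge0 _) sc_unif).
  rewrite -expRM_natl -expRD ler_expR.
  by set X := s%:R * _ => ?; lra.
(* No squaring here: k/12 - k/48 = k/16. *)
have privacy : k%:R / 16 <= s%:R * (6 * eps * (Num.sqrt m%:R * g)).
  have eps01 : 0 <= eps <= 1 by rewrite ltW.
  have := private_mean_le hk k_gt0 g01 v eps01 (sc_ge0 v)
    (score_private hk v dp_A).
  move=> /(le_trans sc_v) mean_le.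
  have := le_trans mean_le (ler_wpM2l (expR_ge0 _) sc_unif).
  rewrite -expRD ler_expR.
  by set X := s%:R * _ => ?; lra.
have sampling_bound : k%:R / (m%:R * alpha ^+ 2) <= 24 * (48 * 48) * s%:R.
  rewrite ler_pdivrMr ?mulr_gt0 ?exprn_gt0 //.
  have : s%:R * (m%:R * g ^+ 2) = 48 * 48 * (s%:R * (m%:R * alpha ^+ 2)).
    by rewrite /g; ring.
  rewrite -[leRHS]mulrA; set X := s%:R * (m%:R * alpha ^+ 2).
  by move=> e; rewrite e in sampling; lra.
have privacy_bound :
    k%:R / (Num.sqrt m%:R * alpha * eps) <= 16 * (6 * 48) * s%:R.
  rewrite ler_pdivrMr ?mulr_gt0 //.
  have : s%:R * (6 * eps * (Num.sqrt m%:R * g)) =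
      6 * 48 * (s%:R * (Num.sqrt m%:R * alpha * eps)) by rewrite /g; ring.
  rewrite -[leRHS]mulrA; set X := s%:R * (Num.sqrt m%:R * alpha * eps).
  by move=> e; rewrite e in privacy; lra.
have s0 : 0 <= s%:R :> R by [].
rewrite ler_pdivrMl; lra.
Qed.
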